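(* Let $T$ be an oriented virtual tangle with ordered components $T_1,\dots,T_n$, equipped with an affine labeling with initial labels $c_1,\dots,c_n$ and index differences $\delta_1,\dots,\delta_n$. Let $d$ be any classical crossing of $T$, let $T_i$ be the component of the overstrand and $T_j$ the component of the understrand at $d$ (possibly $i=j$). Then $$W(d)=\pm\bigl(W^h(d)-\delta_j\bigr),$$ where $W(d)$ is the affine weight, $W^h(d)$ is the homological weight, and the sign is $+$ except when $d$ is a self-crossing that is an early undercrossing of its component, in which case the sign is $-$.
   Context: Virtual tangles: a virtual tangle is represented by a diagram in a square: a planar graph whose vertices are 1-valent (fixed ends, on the top or bottom side of the square) or 4-valent, each 4-valent vertex being a positive or negative classical crossing or a virtual crossing, up to the classical and virtual Reidemeister moves performed away from the 1-valent vertices. Equivalently, it is a tangle in a thickened oriented surface $F$ with boundary (up to Reidemeister moves and stabilization/destabilization), projected generically to $F$; only classical crossings are actual intersections on $F$. Each component is either closed (no 1-valent vertices) or long (exactly two 1-valent vertices). Each closed component has a chosen starting point, and the starting point of a long component is its initial end. Affine labeling: each component $T_i$ starts at its starting point with an arbitrary initial label $c_i$, and labels propagate along the orientation as follows. Draw a classical crossing with both strands oriented upwards. The strand going from bottom left to top right changes its label from $x$ to $x-1$; the strand going from bottom right to top left changes its label from $y$ to $y+1$. This holds irrespective of which strand is over and of the sign of the crossing. Labels do not change at virtual crossings. (A crossing is positive exactly when the overstrand goes from bottom left to top right in this picture, negative otherwise.) The index difference $\delta_i\in\mathbb Z$ is the final label of $T_i$ (at its final end, or on returning to the starting point) minus $c_i$.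 Affine weight: $W(d)=a-b-\operatorname{sgn}(d)$, where $a$ is the incoming label of the overstrand and $b$ the incoming label of the understrand at $d$. Intersection pairing: for transverse oriented cycles $\alpha,\beta\in H_1(F,\partial F)$, $\alpha\cdot\beta$ is the sum over intersection points of $+1$ if the frame $(\alpha,\beta)$ matches the orientation of $F$ and $-1$ otherwise. On diagrams: at a classical crossing drawn with both strands upwards, the contribution is $-1$ if $\beta$ goes from bottom left to top right, and $+1$ if $\beta$ goes from bottom right to top left. Virtual crossings contribute nothing. Smoothing a crossing means the orientation-respecting smoothing; with both strands drawn upwards, it joins the left incoming end to the left outgoing end and the right incoming end to the right outgoing end, and the two resulting pieces through these arcs are the left half and right half. Homological weight $W^h(d)$: (i) Self-crossing of $T_i$: smooth $d$; let $D_s$ be the resulting piece of $T_i$ that contains the starting point of $T_i$, and $D$ the rest of the diagram (including all other components). Then $W^h(d)=D\cdot D_s$. (ii) Mixed crossing of two long components, $T_i$ over $T_j$: smooth $d$; let $D_+$ and $D_-$ be the left and right half respectively. Then $W^h(d)=(c_i-c_j)+(D'\cdot D_\pm)$, where the sign $\pm$ matches the sign of $d$ and $D'$ is the rest of the diagram. (iii) Mixed crossing of $T_i$ over $T_j$ with at least one of $T_i,T_j$ closed: first create a ''bridge'' connecting the strands right after the starting points of $T_i$ and $T_j$, i.e. reconnect them in an orientation-preserving way so that the strand arriving at the start of $T_i$ continues along the start of $T_j$ and the strand arriving at the start of $T_j$ continues along the start of $T_i$, with all crossings between the bridge and other strands virtual. Then smooth $d$; let $D'_+$ and $D'_-$ be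 the left and right half respectively of the merged component. Then $W^h(d)=(c_i-c_j)+(D''\cdot D'_\pm)$, where the sign $\pm$ matches the sign of $d$ and $D''$ is the rest of the diagram. A self-crossing of a component is an early undercrossing (respectively early overcrossing) if, travelling along the component from its starting point in the direction of its orientation, the first passage through the crossing is along the understrand (respectively overstrand). *)

(* Defs.v *)
From HB Require Import structures.
From mathcomp Require Import all_boot all_order all_fingroup all_algebra.

Set Implicit Arguments.
Unset Strict Implicit.
Unset Printing Implicit Defensive.

Import GRing.Theory Num.Theory.
Local Open Scope ring_scope.

Inductive ckind := Positive | Negative | Virtual.

(* An oriented virtual tangle diagram with ordered components and starting
   points.  With both strands of a crossing [x] drawn upwards, the passage
   [(x, true)] is the strand from bottom left to top right and [(x, false)] the
   strand from bottom right to top left.  [strand i] lists the passages met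
   along the i-th component from its starting point (the initial end of a long
   component) to its final end (back to its starting point, if it is closed);
   together with the left/right information this is the oriented 4-valent graph
   with its cyclic orders at the vertices.  Planarity of the diagram is not
   imposed, so that diagrams on arbitrary oriented surfaces are covered as well
   as planar diagrams with virtual crossings. *)
Record vtangle := VTangle {
  ncomp : nat;
  crossing : finType;
  kind : crossing -> ckind;
  long : 'I_ncomp -> bool;
  strand : 'I_ncomp -> seq (crossing * bool);
  strand_once : forall p : crossing * bool,
    (\sum_(i < ncomp) count_mem p (strand i))%N = 1%N
}.

Section Tangle.
Variable T : vtangle.

Local Notation comp := 'I_(ncomp T).
Local Notation passage := (crossing T * bool)%type.

Definition classical (x : crossing T) : bool :=
  if kind x is Virtual then false else true.

(* The value at virtual crossings is irrelevant. *)
Definition sgn (x : crossing T) : int :=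
  match kind x with Positive => 1 | Negative => -1 | Virtual => 0 end.

(* A crossing is positive exactly when the overstrand goes from bottom left to
   top right; the values at virtual crossings are irrelevant. *)
Definition overstrand (x : crossing T) : passage :=
  (x, if kind x is Positive then true else false).
Definition understrand (x : crossing T) : passage :=
  (x, if kind x is Positive then false else true).

Section Labels.
Variable c : comp -> int.

Definition relabel (y : int) (p : passage) : int :=
  if classical p.1 then (if p.2 then y - 1 else y + 1) else y.

(* The incoming label of [i] at the passage [p], for [p] in [strand i]. *)
Definition label_in (i : comp) (p : passage) : int :=
  foldl relabel (c i) (take (index p (strand i)) (strand i)).

Definition index_diff (i : comp) : int :=
  foldl relabel (c i) (strand i) - c i.

(* [i] and [j] are the components of the over- and understrand at [d]. *)
Definition affine_weight (i j : comp) (d : crossing T) : int :=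
  label_in i (overstrand d) - label_in j (understrand d) - sgn d.

End Labels.

(* The points of the diagram: [inl p] is a passage, and [inr i] the starting
   point of the i-th component. *)
Definition point : finType := (passage + comp)%type.

Definition route (i : comp) : seq point := inr i :: map inl (strand i).

(* [follows x y]: the strand leaving [x] next arrives at [y].  Here [next] is
   the cyclic successor; nothing arrives at the initial end of a long
   component. *)
Definition follows : rel point := fun x y =>
  [exists i : comp, [&& x \in route i, y == next (route i) x
                      & ~~ (long i && (y == inr i))]].

(* The strand arriving at [x] continues along the strand that left [y], and
   conversely. *)
Definition reconnect (x y : point) (e : rel point) : rel point :=
  fun u v => e (tperm x y u) v.

(* The strand entering [d] at the bottom left (the passage [(d, true)]) leaves
   at the top left, i.e. as [(d, false)] did, and symmetrically on the right.
   Thus in the smoothed diagram [inl (d, true)] and [inl (d, false)] lie on the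
   left and right arc respectively. *)
Definition smooth (d : crossing T) (e : rel point) : rel point :=
  reconnect (inl (d, true)) (inl (d, false)) e.

(* All crossings between the bridge and other strands are virtual and need not
   be recorded. *)
Definition bridge (i j : comp) (e : rel point) : rel point :=
  reconnect (inr i) (inr j) e.

Definition piece (e : rel point) (x : point) : {set point} :=
  [set y | connect (fun u v => e u v || e v u) x y].

Definition left_half (d : crossing T) (e : rel point) : {set point} :=
  piece (smooth d e) (inl (d, true)).
Definition right_half (d : crossing T) (e : rel point) : {set point} :=
  piece (smooth d e) (inl (d, false)).

(* The half whose side is given by the sign of [d]: left for +, right for -. *)
Definition signed_half (d : crossing T) (e : rel point) : {set point} :=
  if sgn d == 1 then left_half d e else right_half d e.

(* The intersection number [A . B] of two subdiagrams in the diagram smoothed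
   at [d], in which [d] is no longer a crossing: a crossing contributes +1 if [B]
   goes from bottom right to top left there, i.e. if the frame ([A], [B]) is
   positive. *)
Definition pairing (d : crossing T) (A B : {set point}) : int :=
  \sum_(x : crossing T | classical x && (x != d))
     (((inl (x, true) \in A) && (inl (x, false) \in B))%:R
      - ((inl (x, false) \in A) && (inl (x, true) \in B))%:R).

(* [i] and [j] are the components of the over- and understrand at [d]. *)
Definition homological_weight (c : comp -> int) (i j : comp)
    (d : crossing T) : int :=
  if i == j then
    let Ds := piece (smooth d follows) (inr i) in
    pairing d (~: Ds) Ds
  else if long i && long j then
    let H := signed_half d follows in
    c i - c j + pairing d (~: H) H
  else
    let H := signed_half d (bridge i j follows) in
    c i - c j + pairing d (~: H) H.

Definition early_under (i : comp) (d : crossing T) : bool :=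
  (index (understrand d) (strand i) < index (overstrand d) (strand i))%N.

End Tangle.

(* Main.v *)
(* A crossing inside [H] contributes 0 to the label change along [H], and a
   crossing of [H] with the rest contributes its intersection sign, so
   [(~: H) . H] is the total label change along [H], [d] excluded.  Smoothing
   [d] cuts the strands at [d]: the relevant half consists of the part of the
   overstrand component before [d] and the part of the understrand component
   after [d], whether or not a bridge is used (for a self-crossing, [D_s] is the
   part before the first and after the second passage).  Subtracting [delta_j]
   and using that [d] itself changes the label of the understrand by [sgn d]
   leaves the affine weight; for a self-crossing it leaves minus the change
   between the two passages, whence the sign for early undercrossings. *)
Require Import Defs.
From HB Require Import structures.
From mathcomp Require Import all_boot all_order all_fingroup all_algebra.
From mathcomp Require Import ring zify.

Set Implicit Arguments.
Unset Strict Implicit.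
Unset Printing Implicit Defensive.

Import GRing.Theory Num.Theory.
Local Open Scope ring_scope.

(** * Lists and functional paths *)

Lemma split_index_lt (E : eqType) (s : seq E) (p q : E) :
  (index p s < index q s)%N -> q \in s ->
  exists A B C, s = A ++ p :: B ++ q :: C.
Proof.
rewrite -in_take_leq ?index_size // => p_take q_s.
have := cat_take_drop (index q s) s; rewrite drop_index //.
case/splitPr: p_take => A B s_eq; exists A, B, (drop (index q s).+1 s).
by rewrite -{1}s_eq -catA.
Qed.

(** Carries a stretch of an original strand over to a rewired diagram: rewiring touches only how its
    first point is left and how its last point is reached. *)
Lemma fpath_conj (E : eqType) (f h t : E -> E) (x y : E) (s : seq E) :
  {in s, forall u, t u = u} -> {in s, forall u, h u = u} ->
  fpath f (t x) (rcons s y) -> fpath (h \o f \o t) x (rcons s (h y)).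
Proof.
elim: s x => [|a s IHs] x ts hs /=; first by rewrite !andbT => /eqP ->.
case/andP=> /eqP -> fs; rewrite hs ?mem_head // eqxx /=.
apply: IHs => [u us|u us|]; [apply: ts | apply: hs | rewrite ts ?mem_head //].
- by rewrite inE us orbT.
- by rewrite inE us orbT.
Qed.

Section Tangle.
Variable T : vtangle.

Local Notation comp := 'I_(ncomp T).
Local Notation passage := (crossing T * bool)%type.
Local Notation point := (point T).

(** * Label changes along a strand *)

(** Relabeling is a translation, so its value at 0 is the label change at the passage. *)
Definition weight (p : passage) : int := relabel 0 p.

Lemma foldl_relabel (y : int) (s : seq passage) :
  foldl (@relabel T) y s = y + \sum_(p <- s) weight p.
Proof.
elim: s y => [|p s IHs] y /=; first by rewrite big_nil addr0.
rewrite IHs big_cons addrA; congr (_ + _).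
by rewrite /weight /relabel; do 2?case: ifP => _; ring.
Qed.

Lemma index_diffE (c : comp -> int) (i : comp) :
  index_diff c i = \sum_(p <- strand i) weight p.
Proof. by rewrite /index_diff foldl_relabel; ring. Qed.

Lemma mem_strand_unique (i j : comp) (p : passage) :
  p \in strand i -> p \in strand j -> i = j.
Proof.
move=> p_i p_j; apply/eqP; apply: contraT => neq_ij.
have := strand_once p; rewrite (bigD1 i) //= (bigD1 j) 1?eq_sym //=.
move: p_i p_j; rewrite -!has_pred1 !has_count.
case: (count_mem p (strand i)) => // m _;
case: (count_mem p (strand j)) => // n _.
by rewrite !addSn addnS.
Qed.

Lemma mem_strand_ex (p : passage) : exists i : comp, p \in strand i.
Proof.
apply/existsP; apply: contraT; rewrite negb_exists => /forallP p_notin.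
have := strand_once p; rewrite big1 // => i _.
by apply/count_memPn.
Qed.

Lemma strand_uniq (i : comp) : uniq (strand i).
Proof.
apply: count_mem_uniq => p.
have [p_i|/count_memPn //] := boolP (p \in strand i).
have := strand_once p; rewrite (bigD1 i) //=.
move: p_i; rewrite -has_pred1 has_count.
by case: (count_mem p (strand i)) => // -[] // n _; rewrite !addSn.
Qed.

Lemma label_in_split (c : comp -> int) (i : comp) (p : passage) A B :
  strand i = A ++ p :: B -> label_in c i p = c i + \sum_(q <- A) weight q.
Proof.
move=> s_i; have := strand_uniq i; rewrite /label_in foldl_relabel s_i.
rewrite cat_uniq /= negb_or => /and3P[_ /andP[pA _] _].
by rewrite index_cat (negPf pA) /= eqxx addn0 take_size_cat.
Qed.

(** * Routes as cycles of a permutation of the points *)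

Lemma inl_route (i : comp) (p : passage) :
  ((inl p : point) \in route i) = (p \in strand i).
Proof. by rewrite /route inE /= mem_map // => ? ? []. Qed.

Lemma inr_route (i j : comp) : ((inr j : point) \in route i) = (j == i).
Proof. by rewrite inE orbC; case: mapP => [[]|]. Qed.

Lemma route_uniq (i : comp) : uniq (route i).
Proof.
rewrite /= map_inj_uniq ?strand_uniq ?andbT; last by move=> ? ? [].
by apply/mapP => -[].
Qed.

Lemma mem_route_unique (i j : comp) (x : point) :
  x \in route i -> x \in route j -> i = j.
Proof.
case: x => [p|k]; first by rewrite !inl_route; apply: mem_strand_unique.
by rewrite !inr_route => /eqP <- /eqP.
Qed.

Lemma mem_route_ex (x : point) : exists i : comp, x \in route i.
Proof.
case: x => [p|k]; last by exists k; rewrite inr_route.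
by have [i p_i] := mem_strand_ex p; exists i; rewrite inl_route.
Qed.

(* Long components are closed up here, so that [succ] is a permutation;
   [follows] is its graph with the arrows into initial ends removed. *)
Definition succ (x : point) : point :=
  if [pick i : comp | x \in route i] is Some i then next (route i) x else x.

Definition initial_end (x : point) : bool :=
  if x is inr i then long i else false.

Lemma succE (i : comp) (x : point) : x \in route i -> succ x = next (route i) x.
Proof.
move=> x_i; rewrite /succ; case: pickP => [j x_j|/(_ i)]; last by rewrite x_i.
by rewrite (mem_route_unique x_j x_i).
Qed.

(** Points with equal successors lie on a common route, where [prev] undoes [next]. *)
Lemma succ_inj : injective succ.
Proof.
move=> x y; have [[i x_i] [j y_j]] := (mem_route_ex x, mem_route_ex y).
rewrite (succE x_i) (succE y_j) => eq_n.
have eq_ij : i = j.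
  apply: (@mem_route_unique _ _ (next (route i) x)); first by rewrite mem_next.
  by rewrite eq_n mem_next.
subst j; rewrite -(prev_next (route_uniq i) x) eq_n.
exact: prev_next (route_uniq i) y.
Qed.

Lemma followsE (x y : point) :
  follows x y = (y == succ x) && ~~ initial_end y.
Proof.
have end_route i : y \in route i -> long i && (y == inr i) = initial_end y.
  case: y => [p|k] /=; first by rewrite andbF.
  by rewrite inr_route => /eqP ->; rewrite eqxx andbT.
apply/existsP/idP => [[i /and3P[x_i /eqP eq_y]]|].
  have y_i : y \in route i by rewrite eq_y mem_next.
  by rewrite end_route // (succE x_i) -eq_y eqxx.
have [i x_i] := mem_route_ex x.
rewrite (succE x_i) => /andP[/eqP eq_y y_end]; exists i.
by rewrite x_i end_route ?y_end ?eq_y ?eqxx ?mem_next.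
Qed.

(** The cyclic route is cut at its starting point and at [p]. On a long component the last arrow of
    the second arc is the artificial closing one. *)
Lemma fpath_succ (i : comp) A p B :
  strand i = A ++ p :: B ->
  fpath succ (inr i) (rcons (map inl A) (inl p)) /\
  fpath succ (inl p) (rcons (map inl B) (inr i)).
Proof.
move=> s_i; have : fcycle succ (route i).
  have := cycle_next (route_uniq i); apply: sub_in_cycle (allss _) => x y x_i _.
  by rewrite /= (succE x_i).
rewrite /route s_i map_cat /= -cat_rcons rcons_cat cat_path last_rcons.
by case/andP.
Qed.

(** * Pieces of a rewired diagram and their intersection numbers *)

(* Outgoing strands are permuted by [t]; [h] may permute initial ends, which
   does not affect the diagram but splits the cycles of [succ \o t]. *)
Lemma mem_piece_cycle (t h : {perm point}) (e : rel point) (k l : comp)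
    (z : point) (p : passage) (A B : seq passage) :
  (forall u v, e u v = (v == h (succ (t u))) && ~~ initial_end v) ->
  (forall q : passage, h (inl q) = inl q) -> h (inr l) = inr k ->
  {in A ++ B, forall q : passage, t (inl q) = inl q} ->
  fpath succ (t (inr k)) (rcons (map inl A) (inl p)) ->
  fpath succ (t (inl p)) (rcons (map inl B) (inr l)) ->
  z \in inr k :: map inl (A ++ p :: B) ->
  piece e z =i inr k :: map inl (A ++ p :: B).
Proof.
move=> eE h_inl h_l t_id pathA pathB z_s u.
set s : seq point := _ :: _ in z_s *; set g := h \o succ \o t.
have g_inj : injective g.
  by apply: inj_comp; [apply: inj_comp; [apply: perm_inj|apply: succ_inj]
                      |apply: perm_inj].
have h_id (C : seq passage) : {in map inl C, forall v, h v = v}.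
  by move=> _ /mapP[q _ ->].
have cyc : fcycle g s.
  rewrite /= map_cat /= rcons_cat rcons_cons -cat_rcons cat_path last_rcons.
  apply/andP; split.
    rewrite -(h_inl p); apply: fpath_conj pathA => // _ /mapP[q qA ->].
    by rewrite t_id // mem_cat qA.
  rewrite -h_l; apply: fpath_conj pathB => // _ /mapP[q qB ->].
  by rewrite t_id // mem_cat qB orbT.
(* The cycle [s] of the injective [g] is closed under images and preimages, so no arrow of [e]
   enters or leaves it. *)
have g_s v : (g v \in s) = (v \in s).
  rewrite -!(fconnect_cycle cyc (mem_head _ _)).
  by rewrite -(same_fconnect1_r g_inj).
pose e2 := fun a b => e a b || e b a.
have e2_sym : connect_sym e2.
  by apply: sym_connect_sym => a b; rewrite /e2 orbC.
(* Only the closing arrow of the cycle can be missing from [e], and this path avoids it: its targets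
   are passages, never initial ends. *)
have path_s : path e2 (inr k) (map inl (A ++ p :: B)).
  have : fpath g (inr k) (map inl (A ++ p :: B)).
    by move: cyc; rewrite /s /= rcons_path => /andP[].
  elim: (A ++ p :: B) (inr k : point) => //= q r IHr a /andP[/eqP g_a /IHr ->].
  by rewrite andbT /e2 eE -[h _]/(g a) g_a eqxx.
have from_k v : v \in s -> connect e2 (inr k) v by exact: path_connect path_s v.
rewrite inE; apply/idP/idP => [z_u|u_s]; last first.
  by apply: connect_trans (from_k u u_s); rewrite e2_sym from_k.
rewrite -[_ \in _](_ : (z \in s) = _) //; apply: closed_connect z_u => a b.
by rewrite !eE => /orP[] /andP[/eqP -> _]; rewrite g_s.
Qed.

(* For indicators, [(1 - a) b - (1 - b) a = b - a]. *)
Lemma pairing_setC (d : crossing T) (H : {set point}) (s : seq passage) :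
  uniq s -> (forall p : passage, (p \in s) = (p.1 != d) && (inl p \in H)) ->
  pairing d (~: H) H = \sum_(p <- s) weight p.
Proof.
move=> s_uniq s_H; rewrite big_uniq //=.
transitivity (\sum_(x | x != d) \sum_(b | inl (x, b) \in H) weight (x, b)).
  rewrite /pairing big_mkcondl; apply: eq_bigr => x _.
  rewrite big_mkcond big_bool /weight /relabel /= !inE.
  by case: (classical x); do 2!case: (_ \in H).
rewrite pair_big_dep; apply: eq_big => -[x b] //; exact: esym (s_H _).
Qed.

(** The passage [(d, b)] lies on the piece, but [d] is left out of the pairing, so only [A] and [B]
    contribute. *)
Lemma pairing_piece (t h : {perm point}) (e : rel point) (k l : comp)
    (d : crossing T) (b : bool) (z : point) (A B : seq passage) :
  (forall u v, e u v = (v == h (succ (t u))) && ~~ initial_end v) ->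
  (forall q : passage, h (inl q) = inl q) -> h (inr l) = inr k ->
  {in A ++ B, forall q : passage, t (inl q) = inl q} ->
  fpath succ (t (inr k)) (rcons (map inl A) (inl (d, b))) ->
  fpath succ (t (inl (d, b))) (rcons (map inl B) (inr l)) ->
  uniq (A ++ B) -> {in A ++ B, forall q : passage, q.1 != d} ->
  z \in inr k :: map inl (A ++ (d, b) :: B) ->
  pairing d (~: piece e z) (piece e z) =
    \sum_(q <- A) weight q + \sum_(q <- B) weight q.
Proof.
move=> eE h_inl h_l t_id pathA pathB AB_uniq AB_d z_s.
rewrite -big_cat; apply: pairing_setC => // q.
rewrite (mem_piece_cycle eE h_inl h_l t_id pathA pathB) // inE /=.
rewrite mem_map; last by move=> ? ? [].
have := AB_d q; rewrite !mem_cat inE orbCA.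
have [-> /=|_] := eqVneq q (d, b).
  by rewrite eqxx /=; case: (_ || _) => // /(_ isT).
by case: (_ || _) => [->|_] //; rewrite andbF.
Qed.

(** * Smoothing a crossing, with or without a bridge *)

Lemma smoothE (d : crossing T) (b : bool) (e : rel point) (u v : point) :
  smooth d e u v = e (tperm (inl (d, b)) (inl (d, ~~ b)) u) v.
Proof. by rewrite /smooth /reconnect; case: b; rewrite // tpermC. Qed.

Lemma tperm_inl_id (d : crossing T) (b : bool) (q : passage) :
  q.1 != d -> tperm (inl (d, b) : point) (inl (d, ~~ b)) (inl q) = inl q.
Proof. by move=> q_d; rewrite tpermD //; apply: contraNneq q_d => -[<-]. Qed.

Lemma tperm_inr_inl (i j : comp) (q : passage) :
  tperm (inr i : point) (inr j) (inl q) = inl q.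
Proof. by rewrite tpermD. Qed.

Lemma fst_neq (d : crossing T) (b : bool) (s : seq passage) :
  (d, b) \notin s -> (d, ~~ b) \notin s -> {in s, forall q : passage, q.1 != d}.
Proof.
move=> db_s db'_s [x a] q_s /=; apply: contraTneq q_s => ->.
by case: (eqVneq a b) db'_s => [-> //|]; case: a b db_s => -[].
Qed.

(** After [A] the smoothed strand leaves [d] as the second passage did, so [B] is cut off. Arbitrary
    [b] covers early over- and undercrossings alike. *)
Lemma self_pairing (i : comp) (d : crossing T) (b : bool) A B C :
  strand i = A ++ (d, b) :: B ++ (d, ~~ b) :: C ->
  let Ds := piece (smooth d (@follows T)) (inr i) in
  pairing d (~: Ds) Ds = \sum_(q <- A) weight q + \sum_(q <- C) weight q.
Proof.
move=> s_i Ds.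
have /and3P[db_AC db'_AC AC_uniq] :
    [&& (d, b) \notin A ++ C, (d, ~~ b) \notin A ++ C & uniq (A ++ C)].
  have := strand_uniq i; rewrite s_i.
  rewrite (@perm_uniq _ _ (B ++ (d, b) :: (d, ~~ b) :: A ++ C)).
    rewrite cat_uniq !cons_uniq => /and3P[_ _].
    by rewrite inE negb_or -andbA => /andP[].
  apply/seq.permP => a; rewrite !count_cat /= !count_cat /=; lia.
have AC_d := fst_neq db_AC db'_AC.
have s_i' : strand i = (A ++ (d, b) :: B) ++ (d, ~~ b) :: C by rewrite -catA.
apply: (@pairing_piece (tperm (inl (d, b)) (inl (d, ~~ b))) 1 _ i i d b).
- by move=> u v; rewrite (smoothE _ b) followsE perm1.
- by move=> q; rewrite perm1.
- by rewrite perm1.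
- by move=> q /AC_d; apply: tperm_inl_id.
- by rewrite tpermD //; have [] := fpath_succ s_i.
- by rewrite tpermL; have [] := fpath_succ s_i'.
- exact: AC_uniq.
- exact: AC_d.
- exact: mem_head.
Qed.

Lemma mixed_pairing (i j : comp) (d : crossing T) (b : bool) A B A' B'
    (e := if long i && long j then @follows T else bridge i j (@follows T)) :
  i != j ->
  strand i = A ++ (d, b) :: B -> strand j = A' ++ (d, ~~ b) :: B' ->
  let H := piece (smooth d e) (inl (d, b)) in
  pairing d (~: H) H = \sum_(q <- A) weight q + \sum_(q <- B') weight q.
Proof.
move=> neq_ij s_i s_j H.
have disj q : q \in strand i -> q \notin strand j.
  by move=> q_i; apply: contra neq_ij => /(mem_strand_unique q_i) ->.
have [A_uniq db_A] : uniq A /\ (d, b) \notin A.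
  have := strand_uniq i; rewrite s_i cat_uniq /= negb_or.
  by case/and3P=> -> /andP[].
have [B'_uniq db'_B'] : uniq B' /\ (d, ~~ b) \notin B'.
  have := strand_uniq j; rewrite s_j cat_uniq /=.
  by case/and3P=> _ _ /andP[].
have A_i q : q \in A -> q \in strand i by rewrite s_i mem_cat => ->.
have B'_j q : q \in B' -> q \in strand j.
  by rewrite s_j mem_cat inE => ->; rewrite !orbT.
have d_i : (d, b) \in strand i by rewrite s_i mem_cat mem_head orbT.
have d_j : (d, ~~ b) \in strand j by rewrite s_j mem_cat mem_head orbT.
have AB_d : {in A ++ B', forall q : passage, q.1 != d}.
  apply: (@fst_neq d b); rewrite mem_cat negb_or.
    by rewrite db_A; apply: contra (disj _ d_i); apply: B'_j.
  by rewrite db'_B' andbT; apply: contraL d_j => /A_i; apply: disj.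
have AB_uniq : uniq (A ++ B').
  rewrite cat_uniq A_uniq B'_uniq andbT; apply/hasPn => q /B'_j q_j.
  by apply: contraL q_j => /A_i; apply: disj.
have [[pathA _] [_ pathB]] := (fpath_succ s_i, fpath_succ s_j).
have d_mem k : inl (d, b) \in (inr k : point) :: map inl (A ++ (d, b) :: B').
  by rewrite inE /= mem_map ?mem_cat ?mem_head ?orbT // => ? ? [].
rewrite /H {H} /e {e}; case: ifP => [/andP[long_i long_j]|_].
(* The artificial arrow from the end of component [j] is redirected to the start of [i], so that [A]
   and [B'] close up into one cycle. *)
- apply: (@pairing_piece (tperm (inl (d, b)) (inl (d, ~~ b)))
                         (tperm (inr i) (inr j)) _ i j d b) => //.
  + move=> u v; rewrite (smoothE _ b) followsE.
    rewrite -(can2_eq (tpermK _ _) (tpermK _ _)).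
    case: v => [q|k]; first by rewrite tperm_inr_inl.
    (* Both exchanged points are initial ends, where each side of the equation is false. *)
    by case: (tpermP (inr i)) => [[->]|[->]|//];
       rewrite /= ?long_i ?long_j !andbF.
  + exact: tperm_inr_inl.
  + exact: tpermR.
  + by move=> q /AB_d; apply: tperm_inl_id.
  + by rewrite tpermD.
  + by rewrite tpermL.
(* With the bridge, the strand out of [inr j] runs along [A], turns into [B'] at the smoothing and
   returns to [inr j] by itself, so [h] is the identity. *)
- apply: (@pairing_piece (tperm (inl (d, b)) (inl (d, ~~ b))
                          * tperm (inr i) (inr j)) 1 _ j j d b) => //.
  + by move=> u v; rewrite (smoothE _ b) /bridge /reconnect followsE perm1 permM.
  + by move=> q; rewrite perm1.
  + by rewrite perm1.
  + by move=> q q_AB; rewrite permM tperm_inl_id ?AB_d ?tperm_inr_inl.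
  + by rewrite permM (@tpermD _ (inl _)) // tpermR.
  + by rewrite permM tpermL tperm_inr_inl.
Qed.

End Tangle.

(** * Comparison of the two weights *)

Theorem proposition3p2p1 (T : vtangle) (c : 'I_(ncomp T) -> int)
    (d : crossing T) (i j : 'I_(ncomp T))
    (d_classical : classical d)
    (d_over : overstrand d \in strand i) (d_under : understrand d \in strand j) :
  affine_weight c i j d =
    (if (i == j) && early_under i d then -1 else 1)
      * (homological_weight c i j d - index_diff c j).
Proof.
(* The side on which the overstrand enters: left if [d] is positive, right if negative, which is
   also the side picked by [signed_half]. *)
pose b := (overstrand d).2.
have over_d : overstrand d = (d, b) by [].
have under_d : understrand d = (d, ~~ b).
  by rewrite /b /understrand /=; case: kind.
have w_over : weight (d, b) = - sgn d.
  rewrite /weight /relabel d_classical /b /sgn /=.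
  by move: d_classical; rewrite /classical; case: kind.
have w_under : weight (d, ~~ b) = sgn d.
  rewrite /weight /relabel d_classical /b /sgn /=.
  by move: d_classical; rewrite /classical; case: kind.
have halfE e : signed_half d e = piece (smooth d e) (inl (d, b)).
  rewrite /signed_half /sgn /b /=.
  by move: d_classical; rewrite /classical; case: kind.
rewrite /affine_weight /homological_weight index_diffE.
rewrite over_d in d_over *; rewrite under_d in d_under *.
case: (altP (i =P j)) => [eq_ij|neq_ij] /=.
- subst j; rewrite /early_under over_d under_d.
  case: ltngtP => [lt_uo|lt_ou|eq_idx].
  + have [A [B [C s_i]]] := split_index_lt lt_uo d_over.
    (* The double negation lets [self_pairing] apply with first side [~~ b]. The affine weight is
       then the label change along [B], the other difference its negative. *)
    rewrite -{2}(negbK b) in s_i.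
    have s_i' : strand i = (A ++ (d, ~~ b) :: B) ++ (d, b) :: C.
      by rewrite s_i negbK -catA.
    rewrite (self_pairing s_i) (label_in_split c s_i) (label_in_split c s_i').
    rewrite s_i' !(big_cat, big_cons) /= w_over w_under.
    by ring.
  (* Here both differences are minus the label change along [B]. *)
  + have [A [B [C s_i]]] := split_index_lt lt_ou d_under.
    have s_i' : strand i = (A ++ (d, b) :: B) ++ (d, ~~ b) :: C.
      by rewrite s_i -catA.
    rewrite (self_pairing s_i) (label_in_split c s_i) (label_in_split c s_i').
    rewrite s_i' !(big_cat, big_cons) /= w_over w_under.
    by ring.
  (* Equal indices would identify the two passages, forcing [b = ~~ b]. *)
  + have := nth_index (d, b) d_over.
    by rewrite -eq_idx nth_index // => -[]; case: (b).
- have [A [B s_i]] : exists A B, strand i = A ++ (d, b) :: B.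
    by case/splitPr: d_over => A0 B0; exists A0, B0.
  have [A' [B' s_j]] : exists A B, strand j = A ++ (d, ~~ b) :: B.
    by case/splitPr: d_under => A0 B0; exists A0, B0.
  have := mixed_pairing neq_ij s_i s_j.
  rewrite mul1r !halfE (label_in_split c s_i) (label_in_split c s_j) s_j.
  (* [B'] cancels against the tail of the index difference of [j], which leaves the labels before
     [d] and [sgn d]. *)
  by case: ifP => _ /= ->; rewrite big_cat big_cons /= w_under; ring.
Qed.
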